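(* There exist a positive function $x\in M_{1,\infty}$ and a dilation invariant generalised limit $\omega$ on $L_\infty(0,\infty)$ (so that $\tau_\omega$ is a Dixmier trace on $M_{1,\infty}$) such that $$\tau_\omega(x)\neq\omega\Big(t\mapsto\frac{-1}{\log(t)}\int_{1/t}^\infty\lambda\,dn_x(\lambda)\Big).$$
   Context: For a bounded measurable $x$ on $(0,\infty)$, $n_x(\lambda)=m(\{s:|x(s)|>\lambda\})$ ($m$ Lebesgue measure) and $x^*$ is the right-continuous nonincreasing rearrangement of $|x|$; the Stieltjes integral $-\int_z^\infty\lambda\,dn_x(\lambda)$ equals $\int_0^{n_x(z)}x^*(s)ds$. $M_{1,\infty}$ is the space of bounded measurable $x$ on $(0,\infty)$ with $\sup_{t\ge e}\frac1{\log t}\int_0^tx^*(s)ds<\infty$. A generalised limit on $L_\infty(0,\infty)$ is a positive linear functional $\omega$ with $\omega(1)=1$ and $\omega(y)=0$ whenever $y(t)\to0$ as $t\to\infty$; it is dilation invariant if $\omega(\sigma_ny)=\omega(y)$ for all $n\in\mathbb{N}$, where $(\sigma_ny)(t)=y(t/n)$. For such $\omega$, $\tau_\omega(x)=\omega(t\mapsto\frac1{\log t}\int_0^tx^*(s)ds)$ for $0\le x\in M_{1,\infty}$ is additive (a Dixmier trace). Functions of $t$ to which $\omega$ is applied are considered for large $t$; their values on a bounded initial interval do not affect $\omega$. *)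

(* Defs.v *)
From HB Require Import structures.
From mathcomp Require Import all_boot all_order all_algebra.
From mathcomp Require Import all_classical all_reals all_analysis.
Set Implicit Arguments. Unset Strict Implicit. Unset Printing Implicit Defensive.
Import Order.TTheory GRing.Theory Num.Theory.
Import numFieldNormedType.Exports.
Local Open Scope classical_set_scope.
Local Open Scope ring_scope.

Section Defs.
Variable R : realType.
Local Notation mu := (@lebesgue_measure R).

Definition halfline : set R := [set s | 0 < s].

(* bounded measurable function on (0,oo) (values outside (0,oo) are irrelevant) *)
Definition bdd_meas (y : R -> R) : Prop :=
  measurable_fun halfline y /\ exists M : R, forall t, 0 < t -> `|y t| <= M.

Definition distf (x : R -> R) (l : R) : \bar R :=
  mu [set s | 0 < s /\ l < `|x s|].

Definition xstar (x : R -> R) (s : R) : R :=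
  inf [set l : R | 0 <= l /\ (distf x l <= s%:E)%E].

Definition int_xstar (x : R -> R) (t : R) : \bar R :=
  (\int[mu]_(s in [set s : R | (0 <= s <= t)%R]) (xstar x s)%:E)%E.

Definition M1inf (x : R -> R) : Prop :=
  bdd_meas x /\
  exists C : R, forall t, expR 1 <= t -> (int_xstar x t <= (C * ln t)%:E)%E.

(* -int_z^oo l dn_x(l), via the identity given in the context:
   it equals int_0^{n_x(z)} x*(s) ds *)
Definition neg_stieltjes_tail (x : R -> R) (z : R) : \bar R :=
  (\int[mu]_(s in [set s : R | (0 <= s)%R /\ (s%:E < distf x z)%E]) (xstar x s)%:E)%E.

(* generalised limit on L_oo(0,oo): elements represented by bounded measurable
   functions on (0,oo) *)
Definition gen_limit (om : (R -> R) -> R) : Prop :=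
  [/\ forall y z, bdd_meas y -> bdd_meas z -> om (fun t => y t + z t) = om y + om z,
      forall (a : R) y, bdd_meas y -> om (fun t => a * y t) = a * om y,
      forall y, bdd_meas y -> {ae mu, forall t, 0 < t -> 0 <= y t} -> 0 <= om y,
      om (fun=> 1) = 1
    & forall y, bdd_meas y -> y t @[t --> +oo] --> 0 -> om y = 0].

Definition dilation_invariant (om : (R -> R) -> R) : Prop :=
  forall (n : nat) y, bdd_meas y -> om (fun t => y (t / n.+1%:R)) = om y.

Definition avg_fun (x : R -> R) : R -> R :=
  fun t => if t < expR 1 then 0 else fine (int_xstar x t) / ln t.

Definition tau (om : (R -> R) -> R) (x : R -> R) : R := om (avg_fun x).

Definition stieltjes_fun (x : R -> R) : R -> R :=
  fun t => if t < expR 1 then 0 else fine (neg_stieltjes_tail x t^-1) / ln t.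

End Defs.

(* Main.v *)
(** The function [x] is a step function equal to [1/a_k] up to [s_k = L_k a_k],
    where [a_k = exp L_k] and [L_k = 2^k].  The [L_k] double, so the integral of
    [x] over [(0,t)] is [O(log t)].  However, for [t] just above [a_k] the level
    [1/t] lies below the plateau [1/a_k], hence [n_x(1/t) >= s_k], and the
    integral over [(0,n_x(1/t))] exceeds the one over [(0,t)] by at least
    [(s_k - t)/a_k], which is of order [L_k] as long as [t <= s_k/2].  The two
    averages therefore differ by at least 1/4 on the whole window
    [(a_k, a_k L_k/2]].  The logarithmic length of these windows is unbounded,
    so an ultralimit of the normalised integrals of [y(t) dt/t] over them is a
    generalised limit, and it is invariant under dilations, which move only the
    two endpoints of a window by a bounded logarithmic amount. *)
Require Import Defs.
From HB Require Import structures.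
From mathcomp Require Import all_boot all_order all_algebra.
From mathcomp Require Import all_classical all_reals all_analysis.
From mathcomp Require Import measurable_realfun ring lra.
Import Order.TTheory GRing.Theory Num.Theory.
Import numFieldNormedType.Exports.
Local Open Scope classical_set_scope.
Local Open Scope ring_scope.

(** * A dilation invariant limit *)

Section Dilation.
Variable R : realType.
Local Notation mu := (@lebesgue_measure R).

Lemma measurable_halfline : measurable (@halfline R).
Proof. by rewrite /halfline -set_itvoy; exact: measurable_itv. Qed.

Lemma measurable_inv_halfline :
  measurable_fun (@halfline R) (fun t : R => t^-1).
Proof.
rewrite /halfline -set_itvoy; apply: open_continuous_measurable_fun => //.
move=> t; rewrite inE/= in_itv/= andbT => t0.
by apply: inv_continuous; rewrite gt_eqF.
Qed.

Lemma sub_itv_halfline (a b : R) : 0 < a -> `]a, b]%classic `<=` @halfline R.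
Proof.
by move=> a0 t /=; rewrite in_itv/= => /andP[at_ _]; exact: lt_trans at_.
Qed.

Lemma measurable_weighted (y : R -> R) (a b : R) : 0 < a ->
  measurable_fun (@halfline R) y ->
  measurable_fun `]a, b] (fun t => y t / t).
Proof.
move=> a0 my; apply: (measurable_funS measurable_halfline).
  exact: sub_itv_halfline.
by apply: measurable_funM => //; exact: measurable_inv_halfline.
Qed.

(** * Scaling of Lebesgue measure *)

Lemma preimage_scale_itv (c a b : R) : 0 < c ->
  ( *%R c) @^-1` `]a, b]%classic = `]a / c, b / c]%classic.
Proof.
move=> c0; apply/seteqP; split => t /=;
  by rewrite !in_itv/= ltr_pdivrMr// ler_pdivlMr// mulrC.
Qed.

(** Lebesgue measure is determined by its values on half-open intervals, and there the factor c
    undoes the shrinking of the preimage by 1/c. *)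
Lemma lebesgue_measure_scale (c : R) (c0 : 0 < c) (A : set R) : measurable A ->
  pushforward (mscale (NngNum (ltW c0)) mu)
    ( *%R c : _ -> measurableTypeR R) A = mu A.
Proof.
move=> mA; apply/esym/lebesgue_measure_unique => //= _ [[a b]] _ <-.
rewrite /pushforward /mscale/= preimage_scale_itv// !lebesgue_measure_itv/=.
rewrite !lte_fin ltr_pM2r ?invr_gt0//; case: ifPn => _; last by rewrite mule0.
by rewrite -!EFinB -EFinM -mulrBl mulrCA divff ?gt_eqF// mulr1.
Qed.

Lemma ge0_integral_scale (c a b : R) (f : R -> \bar R) : 0 < c ->
  measurable_fun `]a, b] f -> (forall t, a < t <= b -> (0 <= f t)%E) ->
  (\int[mu]_(t in `]a, b]) f t =
   c%:E * \int[mu]_(t in `](a / c)%R, (b / c)%R]) f (c * t)%R)%E.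
Proof.
move=> c0 mf f0.
have f0' : {in `]a, b]%classic, forall t : R, (0 <= f t)%E}.
  by move=> t; rewrite inE/= in_itv/=; exact: f0.
(* The factor c is absorbed into the measure; the right side is then an integral over a preimage
   against a measure whose pushforward is Lebesgue measure. *)
rewrite -[X in X%:E]/((NngNum (ltW c0))%:num).
rewrite -ge0_integral_mscale//=; last 2 first.
- apply: (measurable_comp (F := `]a, b]%classic)) => //.
  by rewrite -preimage_scale_itv// => _ [t + <-].
- move=> t; rewrite in_itv/= ltr_pdivrMr// ler_pdivlMr// mulrC.
  exact: f0.
rewrite (_ : `]a / c, b / c]%classic =
    ( *%R c : _ -> measurableTypeR R) @^-1` `]a, b]%classic); last first.
  by rewrite preimage_scale_itv.
rewrite -ge0_integral_pushforward//=.
apply: eq_measure_integral => //= A mA _.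
exact: esym (lebesgue_measure_scale _ _ _ mA).
Qed.

(** * Integrals against dt/t, the dilation invariant measure on (0,oo) *)

Definition log_int (y : R -> R) (a b : R) : R :=
  \int[mu]_(t in `]a, b]) (y t / t).

Lemma integrable_log (y : R -> R) (a b : R) : 0 < a -> bdd_meas y ->
  mu.-integrable `]a, b] (EFin \o (fun t => y t / t)).
Proof.
move=> a0 [my [M yM]]; apply: measurable_bounded_integrable => //.
- rewrite /= lebesgue_measure_itv/=; case: ifPn => _; last exact: ltry.
  by rewrite -EFinB ltry.
- exact: measurable_weighted.
exists (M / a); split; first exact: num_real.
move=> K MK t /=; rewrite in_itv/= => /andP[at_ tb].
have t0 : 0 < t by exact: lt_trans at_.
apply: le_trans (ltW MK); rewrite normrM normfV (gtr0_norm t0).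
rewrite ler_pM// ?invr_ge0 ?(ltW t0)//; first exact: yM.
by rewrite lef_pV2// ltW.
Qed.

Lemma bdd_meas_cst (c : R) : bdd_meas (fun _ : R => c).
Proof. by split; [exact: measurable_cst|exists `|c|]. Qed.

Lemma bdd_measD (y z : R -> R) : bdd_meas y -> bdd_meas z ->
  bdd_meas (fun t => y t + z t).
Proof.
move=> [my [M yM]] [mz [K zK]]; split; first exact: measurable_funD.
exists (M + K) => t t0; rewrite (le_trans (ler_normD _ _))// lerD//.
  exact: yM.
exact: zK.
Qed.

Lemma bdd_measZ (c : R) (y : R -> R) : bdd_meas y ->
  bdd_meas (fun t => c * y t).
Proof.
move=> [my [M yM]]; split; first exact: measurable_funM.
by exists (`|c| * M) => t t0; rewrite normrM ler_wpM2l// yM.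
Qed.

Lemma bdd_meas_dilation (c : R) (y : R -> R) : 0 < c -> bdd_meas y ->
  bdd_meas (fun t => y (t / c)).
Proof.
move=> c0 [my [M yM]]; split; last first.
  by exists M => t t0; rewrite yM// divr_gt0.
apply: (measurable_comp (F := @halfline R)) => //.
- exact: measurable_halfline.
- by move=> _ [t t0 <-]; exact: divr_gt0.
- exact: mulrr_measurable.
Qed.

Lemma log_intD (y z : R -> R) (a b : R) : 0 < a -> bdd_meas y -> bdd_meas z ->
  log_int (fun t => y t + z t) a b = log_int y a b + log_int z a b.
Proof.
move=> a0 hy hz; rewrite /log_int -RintegralD//; [|exact: integrable_log..].
by apply: eq_Rintegral => t _; rewrite mulrDl.
Qed.

Lemma log_intZ (c : R) (y : R -> R) (a b : R) : 0 < a -> bdd_meas y ->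
  log_int (fun t => c * y t) a b = c * log_int y a b.
Proof.
move=> a0 hy; rewrite /log_int -RintegralZl//; last exact: integrable_log.
by apply: eq_Rintegral => t _; rewrite mulrA.
Qed.

Lemma log_int1 (a b : R) : 0 < a -> a <= b ->
  log_int (fun=> 1) a b = ln b - ln a.
Proof.
move=> a0; rewrite le_eqVlt => /predU1P[<-|ab].
  by rewrite subrr /log_int set_itv_ge ?bnd_simp// Rintegral_set0.
have h : mu.-integrable `]a, b] (EFin \o (fun t => 1 / t)).
  exact/integrable_log/bdd_meas_cst.
rewrite /log_int Rintegral_itv_obnd_cbnd// /Rintegral.
under eq_integral do rewrite mul1r.
have lnc (x : R) : a <= x -> {for x, continuous (@ln R)}.
  by move=> ax; apply: continuous_ln; exact: lt_le_trans ax.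
rewrite (@continuous_FTC2 _ _ (@ln R))//.
- apply: continuous_in_subspaceT => x; rewrite inE/= in_itv/= => /andP[ax _].
  by apply: inv_continuous; rewrite gt_eqF// (lt_le_trans a0).
- split.
  + move=> x; rewrite in_itv/= => /andP[ax _].
    by apply: ex_derive; apply: is_derive1_ln; exact: lt_trans ax.
  + by apply: cvg_at_right_filter; exact: lnc.
  + by apply: cvg_at_left_filter; apply: lnc; exact: ltW.
- move=> x; rewrite in_itv/= => /andP[ax _].
  rewrite derive1E; apply: derive_val; apply: is_derive1_ln.
  exact: lt_trans ax.
Qed.

Lemma log_int_ge (c : R) (y : R -> R) (a b : R) : 0 < a -> a <= b ->
  bdd_meas y -> (forall t, a < t <= b -> c <= y t) ->
  c * (ln b - ln a) <= log_int y a b.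
Proof.
move=> a0 ab hy cy; rewrite -log_int1// -log_intZ//; last exact: bdd_meas_cst.
apply: le_Rintegral => //.
- by apply: integrable_log => //; exact/bdd_measZ/bdd_meas_cst.
- exact: integrable_log.
move=> t /=; rewrite in_itv/= => /[dup] /andP[at_ _] /cy cyt.
by rewrite mulr1 ler_wpM2r// invr_ge0 ltW// (lt_trans a0).
Qed.

Lemma log_int_ge0 (y : R -> R) (a b : R) : 0 < a -> bdd_meas y ->
  {ae mu, forall t, 0 < t -> 0 <= y t} -> 0 <= log_int y a b.
Proof.
move=> a0 hy y0.
have /integrableP[/measurable_EFinP my _] := integrable_log _ _ b a0 hy.
apply: fine_ge0.
(* Positivity is known only almost everywhere, so the integrand is replaced by its absolute value,
   which agrees with it almost everywhere. *)
rewrite (@ae_eq_integral _ _ _ mu `]a, b] (fun t => `|y t / t|%:E))//.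
- by apply: integral_ge0.
- exact/measurable_EFinP.
- by apply/measurable_EFinP; exact: measurableT_comp.
case: y0 => N [mN N0 yN]; exists N; split=> //; apply: subset_trans yN => t.
apply: contra_not => yt; rewrite /= in_itv/= => /andP[at_ _].
have t0 := lt_trans a0 at_.
by rewrite ger0_norm// divr_ge0 ?(ltW t0)// yt.
Qed.

Lemma log_int_le (M : R) (y : R -> R) (a b : R) : 0 < a -> a <= b ->
  bdd_meas y -> (forall t, a < t <= b -> `|y t| <= M) ->
  `|log_int y a b| <= M * (ln b - ln a).
Proof.
move=> a0 ab hy yM; rewrite ler_norml; apply/andP; split.
  rewrite -mulNr; apply: log_int_ge => // t /yM.
  by rewrite ler_norml => /andP[].
rewrite -lerN2 -mulNr -[leRHS]mulN1r -log_intZ//; apply: log_int_ge => //.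
  exact: bdd_measZ.
by move=> t /yM; rewrite mulN1r lerN2 => /ler_normlW.
Qed.

Lemma log_int_split (y : R -> R) (a b c : R) : 0 < a -> a <= b -> b <= c ->
  bdd_meas y -> log_int y a c = log_int y a b + log_int y b c.
Proof.
move=> a0 ab bc hy; rewrite /log_int.
rewrite -(@Rintegral_itvB _ (fun t => y t / t) (BRight a) (BRight c) b)
  ?bnd_simp//; last first.
  exact: integrable_log.
by rewrite addrC subrK.
Qed.

Lemma ge0_log_int_dilation (c a b : R) (y : R -> R) : 0 < c -> 0 < a ->
  bdd_meas y -> (forall t, 0 < t -> 0 <= y t) ->
  log_int (fun t => y (t / c)) a b = log_int y (a / c) (b / c).
Proof.
move=> c0 a0 hy y0; rewrite /log_int /Rintegral; congr fine.
have hyc := bdd_meas_dilation _ _ c0 hy.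
rewrite (ge0_integral_scale c)//; last 2 first.
- apply/measurable_EFinP.
  exact: (measurable_weighted (fun t => y (t / c)) _ _ a0 hyc.1).
- move=> t /andP[at_ _]; have t0 := lt_trans a0 at_.
  by rewrite lee_fin divr_ge0 ?(ltW t0)// y0// divr_gt0.
(* After the substitution the weight 1/(c t) splits off 1/c, which cancels the Jacobian c. *)
transitivity (c%:E * \int[mu]_(t in `](a / c)%R, (b / c)%R])
    ((c^-1)%:E * (y t / t)%:E))%E.
  congr (_ * _)%E; apply: eq_integral => t.
  rewrite inE/= in_itv/= => /andP[act _].
  have t0 : t != 0 by rewrite gt_eqF// (lt_trans _ act)// divr_gt0.
  rewrite -EFinM; congr EFin.
  by rewrite mulrAC divff ?gt_eqF// mul1r; field; rewrite t0 gt_eqF.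
have ac0 : 0 < a / c by rewrite divr_gt0.
rewrite ge0_integralZl//.
- by rewrite muleA -EFinM divff ?gt_eqF// mul1e.
- by apply/measurable_EFinP; exact: (measurable_weighted y _ _ ac0 hy.1).
- move=> t /=; rewrite in_itv/= => /andP[act _].
  have t0 : 0 < t by exact: lt_trans act.
  by rewrite lee_fin divr_ge0 ?y0 ?ltW.
- by rewrite lee_fin invr_ge0 ltW.
Qed.

(* Adding a constant reduces to nonnegative functions. *)
Lemma log_int_dilation (c a b : R) (y : R -> R) : 0 < c -> 0 < a ->
  bdd_meas y ->
  log_int (fun t => y (t / c)) a b = log_int y (a / c) (b / c).
Proof.
move=> c0 a0 hy; have [_ [M yM]] := hy.
have hM := bdd_meas_cst M.
have h : forall t, 0 < t -> 0 <= y t + M.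
  by move=> t /yM; rewrite ler_norml -lerBlDr sub0r => /andP[].
have := ge0_log_int_dilation _ _ b _ c0 a0 (bdd_measD _ _ hy hM) h.
rewrite log_intD//; last exact: bdd_meas_dilation.
rewrite log_intD//; last by rewrite divr_gt0.
suff -> : log_int (fun=> M) a b = log_int (fun=> M) (a / c) (b / c).
  by move/addIr.
have M0 : 0 <= M := le_trans (normr_ge0 _) (yM 1 ltr01).
exact: (ge0_log_int_dilation _ _ _ _ c0 a0 hM).
Qed.

(** * Ultralimits of averages over logarithmic windows *)

Lemma ultra_fmap (T T' : Type) (U : set_system T) (f : T -> T') :
  UltraFilter U -> UltraFilter (fmap f U).
Proof.
move=> UU; split; first exact: fmap_proper_filter.
move=> G GG UG; apply/seteqP; split => // S GS.
have [//|nS] := in_ultra_setVsetC (f @^-1` S) UU.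
have /filter_ex[x []//] : G (S `&` ~` S) by apply: filterI => //; exact: UG.
Qed.

(** The image ultrafilter contains the compact segment [-M, M], hence converges in it. *)
Lemma cvg_ultra_bounded (T : Type) (U : set_system T) (u : T -> R) (M : R) :
  UltraFilter U -> (forall n, `|u n| <= M) -> cvg (u n @[n --> U]).
Proof.
move=> UU uM; have := @segment_compact R (- M) M.
rewrite compact_ultra => /(_ _ (ultra_fmap _ _ _ u UU))[|l [_ ul]].
  by apply: (@filterE _ U) => n /=; rewrite in_itv/= -ler_norml.
by apply/cvg_ex; exists l.
Qed.

Section LogAverage.
Variables (b r : nat -> R).
Hypothesis b0 : forall n, 0 < b n.
Hypothesis r1 : forall n, 1 < r n.
Hypothesis b_oo : b n @[n --> \oo] --> +oo.
Hypothesis r_oo : ln (r n) @[n --> \oo] --> +oo.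

(** The divisor [ln (r n)] is the mass of the window for dt/t, so this is a mean. *)
Let avg (y : R -> R) (n : nat) : R := log_int y (b n) (b n * r n) / ln (r n).

Let lnr0 (n : nat) : 0 < ln (r n).
Proof. exact: ln_gt0. Qed.

Let b_le (n : nat) : b n <= b n * r n.
Proof. by rewrite ler_peMr// ltW. Qed.

Let ln_window (n : nat) : ln (b n * r n) - ln (b n) = ln (r n).
Proof. by rewrite lnM ?posrE// ?(lt_trans ltr01)// addrAC subrr add0r. Qed.

(** Asking for the bound only beyond [b n] serves both bounded functions and, since [b n] tends to
    infinity, functions vanishing at infinity. *)
Let avg_le (M : R) (y : R -> R) (n : nat) : bdd_meas y ->
  (forall t, b n < t -> `|y t| <= M) -> `|avg y n| <= M.
Proof.
move=> hy yM; rewrite normrM normfV (gtr0_norm (lnr0 n)).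
rewrite ler_pdivrMr// -ln_window; apply: log_int_le => //.
by move=> t /andP[+ _]; exact: yM.
Qed.

Let avg_bounded (y : R -> R) : bdd_meas y ->
  exists M, forall n, `|avg y n| <= M.
Proof.
move=> hy; have [_ [M yM]] := hy; exists M => n; apply: avg_le => // t bt.
exact/yM/(lt_trans (b0 n)).
Qed.

Let avgD (y z : R -> R) (n : nat) : bdd_meas y -> bdd_meas z ->
  avg (fun t => y t + z t) n = avg y n + avg z n.
Proof. by move=> hy hz; rewrite /avg log_intD// mulrDl. Qed.

Let avgZ (c : R) (y : R -> R) (n : nat) : bdd_meas y ->
  avg (fun t => c * y t) n = c * avg y n.
Proof. by move=> hy; rewrite /avg log_intZ// mulrA. Qed.

Let avg_cvg0 (y : R -> R) : bdd_meas y -> y t @[t --> +oo] --> 0 ->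
  avg y n @[n --> \oo] --> 0.
Proof.
move=> hy y0; apply/cvgr0Pnorm_le => e e0.
have [T [_ yT]] : \forall t \near +oo, `|y t| <= e.
  by move/cvgr0Pnorm_le : y0; exact.
have := b_oo; move/cvgryPge => /(_ T); apply: filterS => n Tb.
by apply: avg_le => // t bt; apply: yT; exact: le_lt_trans bt.
Qed.

(** Dividing both endpoints of the window by c changes the integral by at most 2 M ln c, which is
    negligible against [ln (r n)]. *)
Let avg_dilation (k : nat) (y : R -> R) : bdd_meas y ->
  avg (fun t => y (t / k.+1%:R)) n - avg y n @[n --> \oo] --> 0.
Proof.
move=> hy; have [_ [M yM]] := hy; apply/cvgr0Pnorm_le => e e0.
set c : R := k.+1%:R.
have c0 : 0 < c by rewrite ltr0n.
have c1 : 1 <= c by rewrite ler1n.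
(* Beyond this threshold the endpoint error 2 M ln c is at most e times [ln (r n)]. *)
have := r_oo; move/cvgryPge => /(_ ((M * ln c + M * ln c) / e)).
apply: filterS => n; rewrite ler_pdivrMr// => re.
have bc0 (x : R) : 0 < x -> 0 < x / c by move=> x0; rewrite divr_gt0.
have bc_le (x : R) : 0 < x -> x / c <= x.
  by move=> x0; rewrite ler_pdivrMr// ler_peMr// ltW.
have ln_c (x : R) : 0 < x -> ln x - ln (x / c) = ln c.
  by move=> x0; rewrite ln_div ?posrE// opprB addrC subrK.
have bM (x : R) : 0 < x -> `|log_int y (x / c) x| <= M * ln c.
  move=> x0; rewrite -(ln_c x)//; apply: log_int_le => //.
  - exact: bc0.
  - exact: bc_le.
  - by move=> t /andP[xt _]; apply: yM; apply: lt_trans xt; exact: bc0.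
have br0 : 0 < b n * r n by rewrite mulr_gt0// (lt_trans ltr01).
rewrite /avg log_int_dilation// -mulrBl normrM normfV (gtr0_norm (lnr0 n)).
rewrite ler_pdivrMr// [leRHS]mulrC (le_trans _ re)//.
(* Splitting at the endpoints, only the two end pieces of logarithmic length
   [ln c] survive. *)
have -> : log_int y (b n / c) (b n * r n / c) - log_int y (b n) (b n * r n) =
    log_int y (b n / c) (b n) - log_int y (b n * r n / c) (b n * r n).
  have h1 := log_int_split y _ _ _ (bc0 _ (b0 n)) (bc_le _ (b0 n)) (b_le n) hy.
  have h2 : log_int y (b n / c) (b n * r n) =
      log_int y (b n / c) (b n * r n / c) +
      log_int y (b n * r n / c) (b n * r n).
    apply: log_int_split => //; [exact: bc0| |exact: bc_le].
    by rewrite ler_pM2r// invr_gt0.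
  lra.
by rewrite (le_trans (ler_normB _ _))// lerD// bM.
Qed.

(** Along an ultrafilter every bounded sequence of means has a limit. The last clause, a lower bound
    checked on the windows alone, is what later separates the two averages. *)
Lemma exists_dilation_invariant_limit : exists om : (R -> R) -> R,
  [/\ gen_limit om, dilation_invariant om &
      forall (c : R) (y : R -> R), bdd_meas y ->
        (forall n t, b n < t <= b n * r n -> c <= y t) -> c <= om y].
Proof.
have [U [UU subU]] := @ultraFilterLemma nat \oo _.
have cvgU (y : R -> R) : bdd_meas y -> cvg (avg y n @[n --> U]).
  by move=> /avg_bounded[M yM]; exact: cvg_ultra_bounded yM.
(* U refines the filter at infinity, so ordinary limits persist along it. *)
have cvgS (u : nat -> R) l : u n @[n --> \oo] --> l -> u n @[n --> U] --> l.
  by move=> ul; apply: cvg_trans ul => V; exact: subU.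
exists (fun y => lim (avg y n @[n --> U])); split.
- split.
  + move=> y z hy hz; apply/cvg_lim => //.
    under eq_fun do rewrite avgD//.
    by apply: cvgD; exact: cvgU.
  + move=> a y hy; apply/cvg_lim => //.
    under eq_fun do rewrite avgZ//.
    by apply: cvgM; [exact: cvg_cst|exact: cvgU].
  + move=> y hy y0; apply: limr_ge; first exact: cvgU.
    apply: filterE => n; apply: divr_ge0; last exact: ltW.
    exact: log_int_ge0.
  + apply/cvg_lim => //; apply: cvgS; apply: cvg_near_cst; apply: nearW => n.
    by rewrite /avg log_int1// ln_window divff// gt_eqF.
  + by move=> y hy y0; apply/cvg_lim => //; apply: cvgS; exact: avg_cvg0.
- move=> k y hy; apply/cvg_lim => //.
  rewrite -[X in _ --> X]add0r.
  have -> : avg (fun t => y (t / k.+1%:R)) =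
      fun n => (avg (fun t => y (t / k.+1%:R)) n - avg y n) + avg y n.
    by apply/funext => n; rewrite subrK.
  by apply: cvgD; [apply: cvgS; exact: avg_dilation|exact: cvgU].
- move=> c y hy cy; apply: limr_ge; first exact: cvgU.
  apply: filterE => n; rewrite ler_pdivlMr// -ln_window.
  by apply: log_int_ge => //; exact: cy.
Qed.

End LogAverage.

End Dilation.

(** * Rearrangement of a nonincreasing function *)

Section Rearrangement.
Variable R : realType.
Local Notation mu := (@lebesgue_measure R).
Variable x : R -> R.
Hypothesis x_ge0 : forall s, 0 <= x s.
Hypothesis x_ni : nonincreasing_fun x.

Let measurable_superlevel (l : R) : measurable [set s : R | 0 < s /\ l < `|x s|].
Proof.
rewrite (_ : mkset _ = `]0, +oo[%classic `&` [set s | l < x s]).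
  rewrite -[X in _ `&` X](_ : x @^-1` `]l, +oo[%classic = _); last first.
    by apply/seteqP; split => s /=; rewrite in_itv/= andbT.
  by apply: nonincreasing_measurable.
by apply/seteqP; split => s /=; rewrite in_itv/= andbT ger0_norm.
Qed.

Lemma distf_le (l s : R) : 0 <= s -> (forall s', s < s' -> x s' <= l) ->
  (distf x l <= s%:E)%E.
Proof.
move=> s0 xl; rewrite -[leRHS](_ : mu `]0, s] = _); last first.
  rewrite lebesgue_measure_itv/= lte_fin; case: ltP => [_|s0'].
    by rewrite -EFinB subr0.
  by congr EFin; apply/le_anti; rewrite s0.
apply: le_measure; rewrite ?inE//=; first exact: measurable_superlevel.
move=> s' [s'0]; rewrite /= in_itv/= s'0/= ger0_norm// leNgt.
by apply: contraTN => /xl; rewrite leNgt.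
Qed.

Lemma distf_ge (l s : R) : 0 <= s -> (forall s', s' < s -> l < x s') ->
  (s%:E <= distf x l)%E.
Proof.
move=> s0 xl; rewrite -[leLHS](_ : mu `]0, s[ = _); last first.
  rewrite lebesgue_measure_itv/= lte_fin; case: ltP => [_|s0'].
    by rewrite -EFinB subr0.
  by congr EFin; apply/le_anti; rewrite s0.
apply: le_measure; rewrite ?inE//=; first exact: measurable_superlevel.
move=> s'; rewrite /= in_itv/= => /andP[s'0 /xl].
by rewrite ger0_norm.
Qed.

Lemma le_distf (l l' : R) : l <= l' -> (distf x l' <= distf x l)%E.
Proof.
move=> ll'; apply: le_measure; rewrite ?inE//=; [exact: measurable_superlevel..|].
by move=> s [s0 xs]; split => //; exact: le_lt_trans xs.
Qed.

Let xstar_set (s : R) : 0 <= s -> [set l | 0 <= l /\ (distf x l <= s%:E)%E] (x s).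
Proof. by move=> s0; split => //; apply: distf_le => // s' /ltW; exact: x_ni. Qed.

Let has_inf_xstar (s : R) : 0 <= s ->
  has_inf [set l | 0 <= l /\ (distf x l <= s%:E)%E].
Proof.
move=> s0; split; first by exists (x s); exact: xstar_set.
by exists 0 => l [].
Qed.

Lemma xstar_ge0 (s : R) : 0 <= s -> 0 <= xstar x s.
Proof. by move=> s0; apply: lb_le_inf => [|l []//]; case: (has_inf_xstar _ s0). Qed.

(** Equality can fail at a jump of x, where the right-continuous [xstar x] takes the limit from the
    right. *)
Lemma xstar_le (s : R) : 0 <= s -> xstar x s <= x s.
Proof.
move=> s0; apply: ge_inf; last exact: xstar_set.
by case: (has_inf_xstar _ s0).
Qed.

(** A level l < c is exceeded on all of ]0, s'[, so [distf x l] is at least s' > s and l is not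
    admissible in the infimum. *)
Lemma xstar_ge (c s s' : R) : 0 <= s < s' ->
  (forall u, u < s' -> c <= x u) -> c <= xstar x s.
Proof.
move=> /andP[s0 ss'] xc; apply: lb_le_inf => [|l [_ dl]].
  by case: (has_inf_xstar _ s0).
rewrite leNgt; apply/negP => lc.
have : (s'%:E <= distf x l)%E.
  apply: distf_ge => [|u /xc]; first exact/ltW/(le_lt_trans s0).
  exact: lt_le_trans.
by move=> /le_trans/(_ dl); rewrite lee_fin leNgt ss'.
Qed.

Lemma xstar_ni (s s' : R) : 0 <= s <= s' -> xstar x s' <= xstar x s.
Proof.
move=> /andP[s0 ss']; have s'0 := le_trans s0 ss'.
apply: lb_le_inf; first by case: (has_inf_xstar _ s0).
move=> l [l0 dl]; apply: ge_inf; first by case: (has_inf_xstar _ s'0).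
by split => //; rewrite (le_trans dl)// lee_fin.
Qed.

Lemma measurable_xstar : measurable_fun `[(0 : R), +oo[ (xstar x).
Proof.
(* For s < 0 the set of levels is empty and [inf] defaults to 0, which can break monotonicity.
   Composing with the maximum with 0 gives a function nonincreasing on the whole line. *)
apply: (eq_measurable_fun (xstar x \o Num.max (0 : R))).
  by move=> s; rewrite inE/= in_itv/= andbT => s0; rewrite max_r.
apply: nonincreasing_measurable => // s s' ss'; apply: xstar_ni.
by rewrite le_max lexx/= ge_max le_max lexx/= le_max ss' orbT.
Qed.

Let measurable_xstarS (D : set R) : measurable D -> D `<=` `[(0 : R), +oo[ ->
  measurable_fun D (fun s => (xstar x s)%:E).
Proof.
by move=> mD D0; apply/measurable_EFinP; apply: measurable_funS measurable_xstar.
Qed.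

Let le_integral_xstar (A B : set R) : measurable A -> measurable B ->
  A `<=` B -> B `<=` `[(0 : R), +oo[ ->
  (\int[mu]_(s in A) (xstar x s)%:E <= \int[mu]_(s in B) (xstar x s)%:E)%E.
Proof.
move=> mA mB AB B0; apply: ge0_subset_integral => //.
  exact: measurable_xstarS.
by move=> s /B0/=; rewrite in_itv/= andbT lee_fin => /xstar_ge0.
Qed.

(** * Integrals of the rearrangement *)

Lemma int_xstarE (t : R) :
  int_xstar x t = (\int[mu]_(s in `[0%R, t]) (xstar x s)%:E)%E.
Proof. by rewrite /int_xstar set_itvcc. Qed.

Lemma int_xstar_ge0 (t : R) : (0 <= int_xstar x t)%E.
Proof.
by apply: integral_ge0 => s /andP[s0 _]; rewrite lee_fin xstar_ge0.
Qed.

Lemma le_int_xstar (s t : R) : s <= t -> (int_xstar x s <= int_xstar x t)%E.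
Proof.
move=> st; rewrite !int_xstarE; apply: le_integral_xstar => // u /=;
  rewrite !in_itv/= => /andP[u0 us]; rewrite u0//=.
exact: le_trans st.
Qed.

Lemma int_xstar0 : int_xstar x 0 = 0%E.
Proof. by rewrite int_xstarE set_itv1 integral_set1. Qed.

Lemma int_xstar_split (s t : R) : 0 <= s <= t ->
  int_xstar x t = (int_xstar x s + \int[mu]_(u in `]s, t]) (xstar x u)%:E)%E.
Proof.
move=> /andP[s0 st]; rewrite !int_xstarE.
rewrite (@itv_bndbnd_setU _ _ _ (BRight s)) ?bnd_simp//.
rewrite ge0_integral_setU//=.
- apply: measurable_xstarS; first exact: measurableU.
  by move=> u [|]/=; rewrite !in_itv/= andbT => /andP[]// /ltW su _; exact: le_trans su.
- move=> u [|]/=; rewrite !in_itv/= lee_fin => /andP[u0 _]; apply: xstar_ge0 => //.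
  exact: le_trans (ltW u0).
- apply/disj_setPS => u [/=]; rewrite !in_itv/= => /andP[_ us] /andP[su _].
  by move: su; rewrite ltNge us.
Qed.

Lemma int_xstar_le (s t c : R) : 0 <= s <= t -> x s <= c ->
  (int_xstar x t <= int_xstar x s + (c * (t - s))%:E)%E.
Proof.
move=> /[dup] st /andP[s0 st'] xc; rewrite (int_xstar_split _ _ st) leeD2l//.
apply: (@le_trans _ _ (\int[mu]_(u in `]s, t]) c%:E)%E).
  apply: ge0_le_integral => //.
  - move=> u /=; rewrite in_itv/= lee_fin => /andP[su _]; apply: xstar_ge0.
    exact: le_trans (ltW su).
  - apply: measurable_xstarS => // u /=; rewrite !in_itv/= andbT => /andP[su _].
    exact: le_trans (ltW su).
  - move=> u /=; rewrite in_itv/= lee_fin => /andP[su _].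
    rewrite (le_trans (xstar_le _ _))//; first exact: le_trans (ltW su).
    by rewrite (le_trans _ xc)// x_ni// ltW.
rewrite integral_cst//= lebesgue_measure_itv/= lte_fin; case: ltP => [_|ts].
  by rewrite -EFinB -EFinM.
by rewrite mule0 lee_fin mulr_ge0// ?subr_ge0// (le_trans _ xc).
Qed.

Lemma int_xstar_ge (s t c : R) : 0 <= s <= t -> 0 <= c ->
  (forall u, u < t -> c <= x u) ->
  (int_xstar x s + (c * (t - s))%:E <= int_xstar x t)%E.
Proof.
move=> /[dup] st /andP[s0 st'] c0 xc; rewrite (int_xstar_split _ _ st) leeD2l//.
(* The endpoint t is dropped because [xstar_ge] needs room to the right of the point: the bound is
   only available for u < t. *)
rewrite -integral_itv_bndo_bndc; last first.
  apply: measurable_xstarS => // u /=; rewrite !in_itv/= andbT => /andP[su _].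
  exact: le_trans (ltW su).
apply: (@le_trans _ _ (\int[mu]_(u in `]s, t[) c%:E)%E).
  rewrite integral_cst//= lebesgue_measure_itv/= lte_fin; case: ltP => [_|ts].
    by rewrite -EFinB -EFinM.
  by rewrite mule0 lee_fin mulr_ge0_le0// subr_le0.
apply: ge0_le_integral => //.
- apply: measurable_xstarS => // u /=; rewrite !in_itv/= andbT => /andP[su _].
  exact: le_trans (ltW su).
- move=> u /=; rewrite in_itv/= lee_fin => /andP[su ut].
  by apply: (@xstar_ge _ _ t) => //; rewrite ut (le_trans s0)// ltW.
Qed.

(** * Truncated Stieltjes integrals *)

Let measurable_tail (z : R) :
  measurable [set s : R | 0 <= s /\ (s%:E < distf x z)%E].
Proof.
apply: is_interval_measurable => a b [a0 _] [_ bz] c /andP[ac cb].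
by split; [exact: le_trans ac|apply: le_lt_trans bz; rewrite lee_fin].
Qed.

Let tail_sub (z : R) :
  [set s : R | 0 <= s /\ (s%:E < distf x z)%E] `<=` `[(0 : R), +oo[.
Proof. by move=> s [s0 _]; rewrite /= in_itv/= s0. Qed.

Lemma neg_stieltjes_tail_ge0 (z : R) : (0 <= neg_stieltjes_tail x z)%E.
Proof. by apply: integral_ge0 => s [s0 _]; rewrite lee_fin xstar_ge0. Qed.

Lemma le_neg_stieltjes_tail (z z' : R) : z <= z' ->
  (neg_stieltjes_tail x z' <= neg_stieltjes_tail x z)%E.
Proof.
move=> zz'; apply: le_integral_xstar => // s [s0 sz]; split => //.
exact/(lt_le_trans sz)/le_distf.
Qed.

(** The domain of the tail is [0, n_x(z)[, so a bound on n_x(z) turns into a comparison of integrals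
    of the nonnegative [xstar x]. *)
Lemma neg_stieltjes_tail_le (z t : R) : (distf x z <= t%:E)%E ->
  (neg_stieltjes_tail x z <= int_xstar x t)%E.
Proof.
move=> zt; rewrite int_xstarE; apply: le_integral_xstar => //.
- move=> s [s0 /lt_le_trans/(_ zt)]; rewrite lte_fin /= in_itv/= s0.
  exact: ltW.
- by move=> s /=; rewrite !in_itv/= andbT => /andP[].
Qed.

Lemma neg_stieltjes_tail_ge (z t : R) : (t%:E <= distf x z)%E ->
  (int_xstar x t <= neg_stieltjes_tail x z)%E.
Proof.
(* The endpoint t is removed since the tail domain is open on the right and misses t when t =
   n_x(z). *)
move=> zt; rewrite int_xstarE -integral_itv_bndo_bndc; last first.
  by apply: measurable_xstarS => // s /=; rewrite !in_itv/= andbT => /andP[].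
apply: le_integral_xstar => // s /=; rewrite in_itv/= => /andP[s0 st]; split => //.
by rewrite (lt_le_trans _ zt)// lte_fin.
Qed.

End Rearrangement.

(** * The step function *)

Section Blocks.
Variable R : realType.

(** [block_log], [block_scale] and [block_end] are the L_k, a_k and s_k of the overview. *)
Definition block_log (k : nat) : R := 2 ^+ k.
Definition block_scale (k : nat) : R := expR (block_log k).
Definition block_end (k : nat) : R := block_log k * block_scale k.

(* The supremum over [k] with [s < block_end k] is attained at the smallest such
   [k]. *)
Definition block_fun (s : R) : R :=
  sup [set r | exists k, s < block_end k /\ r = (block_scale k)^-1].

Lemma block_log_ge1 (k : nat) : 1 <= block_log k.
Proof. by rewrite /block_log exprn_ege1// ler1n. Qed.

Lemma block_logS (k : nat) : block_log k.+1 = 2 * block_log k.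
Proof. by rewrite /block_log exprS. Qed.

Lemma block_scale_gt0 (k : nat) : 0 < block_scale k.
Proof. exact: expR_gt0. Qed.

Lemma block_log_lt_scale (k : nat) : block_log k < block_scale k.
Proof.
by apply: lt_le_trans (expR_ge1Dx _); rewrite addrC ltrDl.
Qed.

Lemma le_block_log (j k : nat) : (j <= k)%N -> block_log j <= block_log k.
Proof. by move=> jk; rewrite /block_log ler_weXn2l// ler1n. Qed.

Lemma le_block_scale (j k : nat) : (j <= k)%N -> block_scale j <= block_scale k.
Proof. by move=> jk; rewrite ler_expR le_block_log. Qed.

Lemma le_block_end (j k : nat) : (j <= k)%N -> block_end j <= block_end k.
Proof.
move=> jk; apply: ler_pM.
- exact: le_trans (block_log_ge1 j).
- exact/ltW/block_scale_gt0.
- exact: le_block_log.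
- exact: le_block_scale.
Qed.

Lemma block_scale_le_end (k : nat) : block_scale k <= block_end k.
Proof. by rewrite ler_peMl ?block_log_ge1// ltW// block_scale_gt0. Qed.

Lemma block_end_ge0 (k : nat) : 0 <= block_end k.
Proof. exact: le_trans (ltW (block_scale_gt0 k)) (block_scale_le_end k). Qed.

Lemma lt_nat_block_log (k : nat) : k%:R < block_log k.
Proof. by rewrite /block_log -natrX ltr_nat ltn_expl. Qed.

Lemma block_exists (s : R) : exists k, s < block_end k.
Proof.
exists (Num.bound `|s|); apply: lt_le_trans (block_scale_le_end _).
apply: lt_trans (block_log_lt_scale _); apply: lt_trans (lt_nat_block_log _).
exact: le_lt_trans (ler_norm s) (archi_boundP (normr_ge0 s)).
Qed.

(** The least such k indexes the plateau containing s; its two properties feed [block_fun_ge] and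
    [block_fun_le], which together give the value 1/a_k. *)
Lemma block_locate (s : R) :
  exists k, s < block_end k /\ (forall j, (j < k)%N -> block_end j <= s).
Proof.
have [k sk kmin] := ex_minnP (block_exists s).
exists k; split => // j jk; rewrite leNgt; apply/negP => /kmin.
by rewrite leqNgt jk.
Qed.

Let block_set_ub (s : R) :
  ubound [set r | exists k, s < block_end k /\ r = (block_scale k)^-1] 1.
Proof.
move=> _ [k [_ ->]]; rewrite invf_le1 ?block_scale_gt0//.
exact: le_trans (block_log_ge1 k) (ltW (block_log_lt_scale k)).
Qed.

Let block_set_n0 (s : R) :
  [set r | exists k, s < block_end k /\ r = (block_scale k)^-1] !=set0.
Proof. by have [k sk] := block_exists s; exists (block_scale k)^-1, k. Qed.

Lemma block_fun_ge (k : nat) (s : R) : s < block_end k ->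
  (block_scale k)^-1 <= block_fun s.
Proof.
move=> sk; apply: ub_le_sup; last by exists k.
by exists 1; exact: block_set_ub.
Qed.

Lemma block_fun_le (k : nat) (s : R) :
  (forall j, (j < k)%N -> block_end j <= s) ->
  block_fun s <= (block_scale k)^-1.
Proof.
move=> ks; apply: ge_sup; first exact: block_set_n0.
move=> _ [j [sj ->]]; rewrite lef_pV2 ?posrE ?block_scale_gt0// le_block_scale//.
by rewrite leqNgt; apply/negP => /ks; rewrite leNgt sj.
Qed.

Lemma block_fun_gt0 (s : R) : 0 < block_fun s.
Proof.
have [k sk] := block_exists s; apply: lt_le_trans (block_fun_ge _ _ sk).
by rewrite invr_gt0 block_scale_gt0.
Qed.

Lemma block_fun_ge0 (s : R) : 0 <= block_fun s.
Proof. exact/ltW/block_fun_gt0. Qed.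

Lemma block_fun_le1 (s : R) : block_fun s <= 1.
Proof. by apply: ge_sup; [exact: block_set_n0|exact: block_set_ub]. Qed.

Lemma block_fun_ni : nonincreasing_fun block_fun.
Proof.
move=> s t st; have [k [sk ks]] := block_locate s.
apply: le_trans (block_fun_ge _ _ sk); apply: block_fun_le => j /ks jt.
exact: le_trans st.
Qed.

(** * Growth of the two integrals and the gap between them *)

Lemma int_xstar_block_end (k : nat) :
  (int_xstar block_fun (block_end k) <= (2 * block_log k)%:E)%E.
Proof.
(* Plateau k contributes at most s_k/a_k = L_k, and as the L_k double, L_0 + ... + L_k stays below 2
   L_k. *)
elim: k => [|k IH].
  have := int_xstar_le _ _ block_fun_ge0 block_fun_ni
    0 (block_end 0) (block_scale 0)^-1.
  rewrite lexx block_end_ge0 => /(_ isT)/(_ _)/le_trans; apply.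
    exact: block_fun_le.
  rewrite int_xstar0 add0e subr0 lee_fin /block_end mulrCA mulVf.
    by rewrite mulr1 ler_peMl ?ler1n// (le_trans _ (block_log_ge1 0)).
  by rewrite gt_eqF// block_scale_gt0.
have := int_xstar_le _ _ block_fun_ge0 block_fun_ni
  (block_end k) (block_end k.+1) (block_scale k.+1)^-1.
rewrite block_end_ge0 le_block_end// => /(_ isT)/(_ _)/le_trans; apply.
  by apply: block_fun_le => j; rewrite ltnS; exact: le_block_end.
apply: (le_trans (leeD2r _ IH)); rewrite -EFinD lee_fin.
rewrite mulrBr {1}/block_end mulrCA mulVf ?gt_eqF ?block_scale_gt0// mulr1.
have : 0 <= (block_scale k.+1)^-1 * block_end k.
  by rewrite mulr_ge0 ?block_end_ge0 ?invr_ge0 ?(ltW (block_scale_gt0 _)).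
rewrite block_logS; lra.
Qed.

(** For t on plateau k+1 the integral is at most 2 L_k + t/a_{k+1}; both L_k and t/a_{k+1} are at
    most ln t. *)
Lemma int_xstar_block_le (t : R) : expR 1 <= t ->
  (int_xstar block_fun t <= (3 * ln t)%:E)%E.
Proof.
move=> et; have t0 : 0 < t by exact: lt_le_trans (expR_gt0 _) et.
have lnt1 : 1 <= ln t by rewrite -(@expRK R 1) ler_ln ?posrE ?expR_gt0.
have [[|k] [tk kt]] := block_locate t.
  (* Plateau 0 ends exactly at e, so it cannot contain t. *)
  move: tk; rewrite /block_end /block_scale /block_log expr0 mul1r.
  by rewrite ltNge et.
have := int_xstar_le _ _ block_fun_ge0 block_fun_ni
  (block_end k) t (block_scale k.+1)^-1.
rewrite block_end_ge0 kt// => /(_ isT)/(_ _)/le_trans; apply.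
  by apply: block_fun_le => j; rewrite ltnS; exact: le_block_end.
apply: (le_trans (leeD2r _ (int_xstar_block_end k))); rewrite -EFinD lee_fin.
have h1 : block_log k <= ln t.
  rewrite -[leLHS]expRK ler_ln ?posrE ?expR_gt0//.
  exact: le_trans (block_scale_le_end k) (kt _ (ltnSn k)).
have h2 : (block_scale k.+1)^-1 * t <= ln t.
  rewrite mulrC ler_pdivrMr ?block_scale_gt0//.
  (* Below a_{k+1} the quotient is at most 1; above, it is at most L_{k+1} = ln a_{k+1}, which is at
     most ln t. *)
  have [ta|at_] := leP t (block_scale k.+1).
    by rewrite (le_trans ta)// ler_peMl// ltW// block_scale_gt0.
  apply: (le_trans (ltW tk)); apply: ler_wpM2r.
    exact/ltW/block_scale_gt0.
  by rewrite -[leLHS]expRK ler_ln ?posrE ?expR_gt0// ltW.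
have h3 : 0 <= (block_scale k.+1)^-1 * block_end k.
  by rewrite mulr_ge0 ?block_end_ge0 ?invr_ge0 ?(ltW (block_scale_gt0 _)).
rewrite mulrBr; lra.
Qed.

(** If the plateau of s had a_k < t, then L_k < a_k < t would give s < L_k a_k <= t^2; so beyond t^2
    the function is at most 1/t. *)
Lemma distf_block_le (t : R) : 0 < t -> (distf block_fun t^-1 <= (t ^+ 2)%:E)%E.
Proof.
move=> t0; apply: distf_le; [exact: block_fun_ge0|exact: block_fun_ni| |].
  exact: sqr_ge0.
move=> s ts; have [k [sk ks]] := block_locate s.
apply: (le_trans (block_fun_le _ _ ks)); rewrite lef_pV2 ?posrE ?block_scale_gt0//.
rewrite leNgt; apply/negP => at_; move: (lt_trans ts sk); apply/negP.
have le_at := ltW at_; rewrite -leNgt expr2; apply: ler_pM => //.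
- exact: le_trans (block_log_ge1 k).
- exact/ltW/block_scale_gt0.
- exact: le_trans (ltW (block_log_lt_scale k)) le_at.
Qed.

(** The tail stops by t^2, and 3 ln (t^2) = 6 ln t. This makes the second average bounded. *)
Lemma neg_stieltjes_tail_block_le (t : R) : expR 1 <= t ->
  (neg_stieltjes_tail block_fun t^-1 <= (6 * ln t)%:E)%E.
Proof.
move=> et; have t0 : 0 < t by exact: lt_le_trans (expR_gt0 _) et.
have d := distf_block_le _ t0.
apply: (le_trans (neg_stieltjes_tail_le _ _ block_fun_ge0 block_fun_ni _ _ d)).
have et2 : expR 1 <= t ^+ 2.
  have t1 : 1 <= t by apply: le_trans et; apply: ltW; rewrite expR_gt1.
  by rewrite (le_trans et)// expr2 ler_peMr// ltW.
apply: (le_trans (int_xstar_block_le _ et2)); rewrite lee_fin lnXn//.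
by rewrite -mulr_natl; lra.
Qed.

(** The factor 2^k is L_{k+1}/2, so the excess L_{k+1} - t/a_{k+1} is at least L_k. Since ln t <= 3
    L_k, a quarter of ln t fits. *)
Lemma stieltjes_gap (k : nat) (t : R) :
  block_scale k.+1 < t <= block_scale k.+1 * 2 ^+ k ->
  (int_xstar block_fun t + (ln t / 4)%:E <=
   neg_stieltjes_tail block_fun t^-1)%E.
Proof.
move=> /andP[at_ tb]; have a0 := block_scale_gt0 k.+1.
have t0 : 0 < t by exact: lt_trans at_.
have tend : t <= block_end k.+1.
  rewrite (le_trans tb)// mulrC ler_wpM2r ?(ltW a0)//.
  exact: le_block_log.
(* As t > a_{k+1}, the level 1/t is strictly below the plateau value 1/a_{k+1}, so all of ]0,
   s_{k+1}[ lies above that level. *)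
have d : ((block_end k.+1)%:E <= distf block_fun t^-1)%E.
  apply: distf_ge; [exact: block_fun_ge0|exact: block_fun_ni| |].
    exact: le_trans (ltW t0) tend.
  move=> s /block_fun_ge; apply: lt_le_trans.
  by rewrite ltf_pV2.
apply: le_trans (neg_stieltjes_tail_ge _ _ block_fun_ge0 block_fun_ni _ _ d).
have := int_xstar_ge _ _ block_fun_ge0 block_fun_ni
  t (block_end k.+1) (block_scale k.+1)^-1.
rewrite (ltW t0) tend invr_ge0 (ltW a0) => /(_ isT isT)/(_ _).
move=> /(_ _)/(le_trans _); apply; last by move=> u; exact: block_fun_ge.
rewrite leeD2l// lee_fin mulrBr {1}/block_end mulrCA mulVf ?gt_eqF// mulr1.
have h1 : (block_scale k.+1)^-1 * t <= block_log k.
  by rewrite mulrC ler_pdivrMr// mulrC.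
have h2 : ln t <= 2 * block_log k + block_log k.
  have <- : ln (block_scale k.+1) + ln (expR (block_log k)) =
      2 * block_log k + block_log k.
    by rewrite !expRK block_logS.
  rewrite -lnM ?posrE ?expR_gt0// ler_ln ?posrE ?mulr_gt0 ?expR_gt0//.
  rewrite (le_trans tb)// ler_wpM2l ?(ltW a0)//.
  exact/ltW/(block_log_lt_scale k).
have := block_log_ge1 k; rewrite block_logS; lra.
Qed.

End Blocks.

(** * Boundedness of the two averages and the final comparison *)

Lemma bdd_meas_log_quotient (R : realType) (G : R -> R) (C : R) :
  (forall s t, expR 1 <= s <= t -> G s <= G t) ->
  (forall t, expR 1 <= t -> 0 <= G t <= C * ln t) ->
  bdd_meas (fun t => if t < expR 1 then 0 else G t / ln t).
Proof.
move=> G_nd GC.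
have ln1 (t : R) : expR 1 <= t -> 1 <= ln t.
  move=> et; rewrite -(@expRK R 1) ler_ln ?posrE ?expR_gt0//.
  exact: lt_le_trans (expR_gt0 1) et.
split; last first.
  exists `|C| => t t0; case: ltP => [_|et]; first by rewrite normr0.
  have lt0 : 0 < ln t by exact: lt_le_trans (ln1 _ et).
  have /andP[G0 Gt] := GC _ et.
  rewrite ger0_norm ?divr_ge0 ?(ltW lt0)// ler_pdivrMr// (le_trans Gt)//.
  by rewrite ler_wpM2r ?(ltW lt0)// ler_norm.
(* Measurability comes from a product of two monotone functions. The values 0 and 1 below e keep
   them monotone, because G >= 0 and 1/ln t <= 1 from e on. *)
rewrite (_ : (fun t => _) = (fun t => if t < expR 1 then 0 else G t) \*
    (fun t => if t < expR 1 then 1 else (ln t)^-1)); last first.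
  by apply/funext => t /=; case: ifP; rewrite ?mulr1.
apply: measurable_funM.
- apply: nondecreasing_measurable; first exact: measurable_halfline.
  move=> s t st; case: (ltP t) => [te|et]; first by rewrite (le_lt_trans st te).
  by case: ltP => [_|es]; [case/andP: (GC _ et)|rewrite G_nd// es].
- apply: nonincreasing_measurable; first exact: measurable_halfline.
  move=> s t st; case: (ltP t) => [te|et]; first by rewrite (le_lt_trans st te).
  have lt1 := ln1 _ et.
  case: ltP => [_|es]; first by rewrite invf_le1// (lt_le_trans ltr01).
  have ls1 := ln1 _ es.
  rewrite lef_pV2 ?posrE ?(lt_le_trans ltr01)// ler_ln ?posrE//.
    exact: lt_le_trans (expR_gt0 1) es.
  exact: lt_le_trans (expR_gt0 1) et.
Qed.

Theorem theorem1p5 (R : realType) :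
  exists (x : R -> R) (om : (R -> R) -> R),
    [/\ (forall s : R, 0 < s -> 0 <= x s),
        M1inf x,
        gen_limit om /\ dilation_invariant om,
        bdd_meas (avg_fun x) /\ bdd_meas (stieltjes_fun x)
      & tau om x != om (stieltjes_fun x)].
Proof.
pose x := @block_fun R.
have x0 : forall s, 0 <= x s := @block_fun_ge0 R.
have x_ni : nonincreasing_fun x := @block_fun_ni R.
have e0 : 0 < expR 1 :> R := expR_gt0 1.
(* The integrals are finite from e on, so [fine] loses nothing there. *)
have fin0 (u : \bar R) (c : R) : (0 <= u)%E -> (u <= c%:E)%E ->
    u = (fine u)%:E /\ 0 <= fine u <= c.
  move=> u0 uc; have uE : u = (fine u)%:E.
    by rewrite fineK// ge0_fin_numE// (le_lt_trans uc) ?ltry.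
  by split => //; rewrite -!lee_fin -uE u0.
have intE t : expR 1 <= t ->
    int_xstar x t = (fine (int_xstar x t))%:E /\
    0 <= fine (int_xstar x t) <= 3 * ln t.
  by move=> et; apply: fin0; [exact: int_xstar_ge0|exact: int_xstar_block_le].
have tailE t : expR 1 <= t ->
    neg_stieltjes_tail x t^-1 = (fine (neg_stieltjes_tail x t^-1))%:E /\
    0 <= fine (neg_stieltjes_tail x t^-1) <= 6 * ln t.
  move=> et; apply: fin0; first exact: neg_stieltjes_tail_ge0.
  exact: neg_stieltjes_tail_block_le.
have avg_bdd : bdd_meas (avg_fun x).
  apply: (bdd_meas_log_quotient _ _ 3) => [s t /andP[es st]|t /intE[]//].
  have [sE _] := intE _ es; have [tE _] := intE _ (le_trans es st).
  by rewrite -lee_fin -sE -tE le_int_xstar.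
have stieltjes_bdd : bdd_meas (stieltjes_fun x).
  apply: (bdd_meas_log_quotient _ _ 6) => [s t /andP[es st]|t /tailE[]//].
  have [sE _] := tailE _ es; have [tE _] := tailE _ (le_trans es st).
  rewrite -lee_fin -sE -tE le_neg_stieltjes_tail//.
  by rewrite lef_pV2 ?posrE ?(lt_le_trans e0)// (le_trans es).
(* These are the windows of [stieltjes_gap] with k = n+1; starting at k = 1 keeps the ratio 2^k
   above 1. *)
have [|n|||om [om_lim om_dil om_ge]] := exists_dilation_invariant_limit R
  (fun n => block_scale R n.+2) (fun n => 2 ^+ n.+1).
- by move=> n; exact: block_scale_gt0.
- by rewrite exprn_egt1// ltr1n.
- apply/cvgryPge => A; near=> n.
  have An : A <= n%:R by near: n; exact: nbhs_infty_ger.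
  rewrite (le_trans An)// (le_trans _ (ltW (block_log_lt_scale _ _)))//.
  by rewrite (le_trans _ (ltW (lt_nat_block_log _ _)))// ler_nat -addn2 leq_addr.
- apply/cvgryPge => A; near=> n.
  have ln2 : 0 < ln 2 :> R by rewrite ln_gt0// ltr1n.
  have An : A / ln 2 <= n%:R by near: n; exact: nbhs_infty_ger.
  rewrite lnXn// -[leRHS]mulr_natl -ler_pdivrMr// (le_trans An)//.
  by rewrite ler_nat.
exists x, om; split => //.
- split; last by exists 3; exact: int_xstar_block_le.
  split; last by exists 1 => t _; rewrite ger0_norm// block_fun_le1.
  by apply: nonincreasing_measurable => //; exact: measurable_halfline.
have [omD omZ _ _ _] := om_lim.
(* The difference of the averages is at least 1/4 on every window; it is written with the factor -1
   so that additivity and homogeneity of [om] apply. Equal limits would then give 1/4 <= 0. *)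
have gap : 4^-1 <= om (fun t => stieltjes_fun x t + -1 * avg_fun x t).
  apply: om_ge; first by apply: bdd_measD => //; exact: bdd_measZ.
  move=> n t tw; have /andP[at_ _] := tw.
  have et : expR 1 <= t.
    by rewrite (le_trans _ (ltW at_))// ler_expR block_log_ge1.
  have lt0 : 0 < ln t by rewrite ln_gt0// (lt_le_trans _ et)// expR_gt1.
  rewrite /stieltjes_fun /avg_fun ltNge et/= mulN1r -mulrBl ler_pdivlMr//.
  have [iE _] := intE _ et; have [sE _] := tailE _ et.
  have := stieltjes_gap _ _ _ tw; rewrite iE sE -EFinD lee_fin; lra.
apply/eqP => tauE; move: gap; rewrite omD//; last exact: bdd_measZ.
by rewrite omZ// -tauE mulN1r subrr; apply/negP; rewrite -ltNge invr_gt0.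
Unshelve. all: by end_near. Qed.
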